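(* Let $Q=\mathbb{R}^n$, let $b,m>0$, let $M=mI_n$ be the diagonal matrix with all diagonal entries equal to $m$, and let $K$ be a symmetric positive definite real $n\times n$ matrix that commutes with $M^{-1}$. Consider the contact Lagrangian $L:TQ\times\mathbb{R}\to\mathbb{R}$, $$L(q,\dot q,z)=\tfrac12\dot q^{T}M\dot q-\tfrac12 q^{T}Kq-\tfrac{b}{m}z,$$ and let $\Gamma$ be its contact Lagrangian vector field on $TQ\times\mathbb{R}$. Then there exist an open neighbourhood $\mathcal{U}$ of $(0,0)\in TQ\times\mathbb{R}$ (the point $q=0$, $\dot q=0$, $z=0$) and a parameter $\varepsilon$ such that $(TQ\times\mathbb{R},\Gamma,\mathbb{G}_\varepsilon,\mathcal{U})$ is a contracting system, where $\mathbb{G}_\varepsilon$ is the contact contraction metric with parameter $\varepsilon$.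
   Context: The equations of motion of a contact Lagrangian $L(q,\dot q,z)$ are $\frac{d}{dt}\frac{\partial L}{\partial\dot q^i}-\frac{\partial L}{\partial q^i}=\frac{\partial L}{\partial\dot q^i}\frac{\partial L}{\partial z}$, $\dot z=L$. For the Lagrangian in the claim the corresponding vector field on $TQ\times\mathbb{R}$ is $$\Gamma(q,\dot q,z)=\Big(\dot q,\;-M^{-1}\big(Kq+\tfrac{b}{m}M\dot q\big),\;\tfrac12\dot q^{T}M\dot q-\tfrac12q^{T}Kq-\tfrac{b}{m}z\Big).$$ The contact contraction metric with parameter $\varepsilon$ is the Riemannian metric on $TQ\times\mathbb{R}\cong\mathbb{R}^{2n+1}$ given, in the coordinates $(q,\dot q,z)$, by the constant block matrix $$\mathbb{G}_\varepsilon=\begin{bmatrix}K & b\varepsilon I_n & 0\\ b\varepsilon I_n & M & 0\\ 0&0&b\end{bmatrix}.$$ A contracting system is a tuple $(N,X,g,\mathcal{U})$, where $N$ is a smooth manifold, $X$ is a smooth vector field on $N$, $g$ is a Riemannian metric on $N$ (in particular positive definite) and $\mathcal{U}\subseteq N$ is open, such that there exists $\lambda>0$ with $(\mathcal{L}_X g)(v_x,v_x)\leq-2\lambda\,g(v_x,v_x)$ for all $x\in\mathcal{U}$ and $v_x\in T_xN$. Here $\mathcal{L}_X g$ is the Lie derivative of $g$ along $X$. *)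

(* Defs.v *)
From HB Require Import structures.
From mathcomp Require Import all_boot all_order all_algebra.
From mathcomp Require Import boolp classical_sets functions reals topology.
From mathcomp Require Import normedtype derive ring.
Set Implicit Arguments.
Unset Strict Implicit.
Unset Printing Implicit Defensive.
Import Order.TTheory GRing.Theory Num.Theory numFieldNormedType.Exports.
Local Open Scope ring_scope.
Local Open Scope classical_set_scope.

(* Class C^k for maps between normed spaces (the source being finite-           *)
(* dimensional): every directional derivative is again of class C^(k-1).        *)
Fixpoint class_C (R : realType) (V W : normedModType R) (k : nat) (f : V -> W) :
    Prop :=
  if k is k'.+1 then
    (forall x, differentiable f x) /\ (forall v, class_C k' ('D_v f))
  else continuous f.

Definition smooth (R : realType) (V W : normedModType R) (f : V -> W) : Prop :=
  forall k, class_C k f.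

Definition bilin (R : realType) (d : nat) (A : 'M[R]_d) (u v : 'cV[R]_d) : R :=
  (u^T *m A *m v) 0 0.

Definition sym_posdef (R : realType) (d : nat) (A : 'M[R]_d) : Prop :=
  A^T = A /\ forall v : 'cV[R]_d, v != 0 -> 0 < bilin A v v.

(* In the global chart of R^d, a vector field is a map 'cV_d -> 'cV_d and a     *)
(* metric is the map sending a point to its Gram matrix in the coordinate frame. *)
Definition riemannian_metric (R : realType) (d : nat)
    (g : 'cV[R]_d -> 'M[R]_d) : Prop :=
  smooth g /\ forall x, sym_posdef (g x).

Definition lie_bracket (R : realType) (d : nat) (X Y : 'cV[R]_d -> 'cV[R]_d) :
    'cV[R]_d -> 'cV[R]_d :=
  fun x => 'D_(X x) Y x - 'D_(Y x) X x.

(* (L_X g)(Y, Z) = X(g(Y, Z)) - g([X, Y], Z) - g(Y, [X, Z]); L_X g is a tensor,  *)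
(* so its value on tangent vectors u, v at x may be computed by extending them  *)
(* to the constant fields.                                                      *)
Definition lie_derivative (R : realType) (d : nat) (X : 'cV[R]_d -> 'cV[R]_d)
    (g : 'cV[R]_d -> 'M[R]_d) (x u v : 'cV[R]_d) : R :=
  'D_(X x) (fun y => bilin (g y) u v) x
  - bilin (g x) (lie_bracket X (cst u) x) v
  - bilin (g x) u (lie_bracket X (cst v) x).

Definition contracting_system (R : realType) (d : nat)
    (X : 'cV[R]_d -> 'cV[R]_d) (g : 'cV[R]_d -> 'M[R]_d)
    (U : set 'cV[R]_d) : Prop :=
  [/\ smooth X, riemannian_metric g, open U &
      exists2 lambda : R, 0 < lambda &
        forall x, U x -> forall v,
          lie_derivative X g x v v <= - 2 * lambda * bilin (g x) v v].

(* TQ x R for Q = R^n, with the coordinates (q, q', z) stacked in this order.   *)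
Notation TQR R n := 'cV[R]_(n + n + 1).

Definition tqr (R : realType) (n : nat) (q v : 'cV[R]_n) (z : R) : TQR R n :=
  col_mx (col_mx q v) z%:M.

Definition q_of (R : realType) (n : nat) (x : TQR R n) : 'cV[R]_n :=
  usubmx (usubmx x).
Definition v_of (R : realType) (n : nat) (x : TQR R n) : 'cV[R]_n :=
  dsubmx (usubmx x).
Definition z_of (R : realType) (n : nat) (x : TQR R n) : R := dsubmx x 0 0.

Definition d_q (R : realType) (n : nat) (L : TQR R n -> R) (i : 'I_n) :
    TQR R n -> R := 'D_(tqr (delta_mx i 0) 0 0) L.
Definition d_v (R : realType) (n : nat) (L : TQR R n -> R) (i : 'I_n) :
    TQR R n -> R := 'D_(tqr 0 (delta_mx i 0) 0) L.
Definition d_z (R : realType) (n : nat) (L : TQR R n -> R) : TQR R n -> R :=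
  'D_(tqr 0 0 1) L.

(* The vector field whose integral curves are the solutions of the equations of *)
(* motion of L (Herglotz equations): along them d/dt is the derivative along X. *)
(* Meaningful for smooth L, as 'D is a total operator.                          *)
Definition contact_lagrangian_field (R : realType) (n : nat)
    (L : TQR R n -> R) (X : TQR R n -> TQR R n) : Prop :=
  forall x : TQR R n,
    [/\ q_of (X x) = v_of x,
        forall i, 'D_(X x) (d_v L i) x - d_q L i x = d_v L i x * d_z L x &
        z_of (X x) = L x].

Definition damped_lagrangian (R : realType) (n : nat) (b m : R) (M K : 'M[R]_n) :
    TQR R n -> R :=
  fun x => 2^-1 * bilin M (v_of x) (v_of x) - 2^-1 * bilin K (q_of x) (q_of x)
           - b / m * z_of x.

Definition contact_contraction_metric (R : realType) (n : nat) (b : R)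
    (M K : 'M[R]_n) (eps : R) : 'M[R]_(n + n + 1) :=
  block_mx (block_mx K (b * eps)%:M (b * eps)%:M M) 0 0 b%:M.

Definition damped_field (R : realType) (n : nat) (b m : R) (M K : 'M[R]_n)
    (x : TQR R n) : TQR R n :=
  let: q := q_of x in let: v := v_of x in
  tqr v (- (invmx M *m (K *m q + (b / m) *: (M *m v))))
    (2^-1 * bilin M v v - 2^-1 * bilin K q q - b / m * z_of x).

Lemma derive_quadratic (R : realType) (V : normedModType R) (F : V -> R) x v a c :
  (forall h, F (h *: v + x) = F x + h * a + h * h * c) -> 'D_v F x = a.
Proof.
move=> FE; rewrite /derive; apply/cvg_lim => //.
have -> : a = a + 0 * c by rewrite mul0r addr0.
apply: (@cvg_trans _ ((fun h : R => a + h * c) @ 0^')).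
  apply: near_eq_cvg; near=> h.
  have h0 : h != 0 by near: h; exact: nbhs_dnbhs_neq.
  by rewrite /= FE /GRing.scale /=; field.
suff: (fun h : R => a + h * c) @ 0 --> a + 0 * c.
  by apply: cvg_trans; apply: cvg_app; exact: cvg_within.
by apply: cvgD; [exact: cvg_cst | apply: cvgM; [exact: cvg_id | exact: cvg_cst]].
Unshelve. all: by end_near. Qed.

Lemma tqr_eta (R : realType) n (x : TQR R n) : x = tqr (q_of x) (v_of x) (z_of x).
Proof. by rewrite /tqr /q_of /v_of /z_of -mx11_scalar !vsubmxK. Qed.

Lemma q_ofK (R : realType) n q v z : q_of (tqr q v z : TQR R n) = q.
Proof. by rewrite /q_of /tqr !col_mxKu. Qed.
Lemma v_ofK (R : realType) n q v z : v_of (tqr q v z : TQR R n) = v.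
Proof. by rewrite /v_of /tqr col_mxKu col_mxKd. Qed.
Lemma z_ofK (R : realType) n q v z : z_of (tqr q v z : TQR R n) = z.
Proof. by rewrite /z_of /tqr col_mxKd mxE eqxx. Qed.

Lemma q_ofP (R : realType) n h (x y : TQR R n) :
  q_of (h *: x + y) = h *: q_of x + q_of y.
Proof. by rewrite /q_of !linearP. Qed.
Lemma v_ofP (R : realType) n h (x y : TQR R n) :
  v_of (h *: x + y) = h *: v_of x + v_of y.
Proof. by rewrite /v_of !linearP. Qed.
Lemma z_ofP (R : realType) n h (x y : TQR R n) :
  z_of (h *: x + y) = h * z_of x + z_of y.
Proof. by rewrite /z_of !linearP !mxE. Qed.

Lemma bilinP (R : realType) n (A : 'M[R]_n) h x y : A^T = A ->
  bilin A (h *: x + y) (h *: x + y)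
  = bilin A y y + h * (2 * bilin A x y) + h * h * bilin A x x.
Proof.
move=> AT; have S : bilin A y x = bilin A x y.
  rewrite /bilin -[in RHS](trmxK (x^T *m A *m y)) [RHS]mxE.
  by rewrite !trmx_mul AT trmxK mulmxA.
have E (P Q : 'M[R]_1) : (P + Q) 0 0 = P 0 0 + Q 0 0 by rewrite mxE.
have Z (k : R) (P : 'M[R]_1) : (k *: P) 0 0 = k * P 0 0 by rewrite mxE.
move: S; rewrite /bilin => S.
have -> : (h *: x + y)^T = h *: x^T + y^T by rewrite linearP.
rewrite !(mulmxDl, mulmxDr) -!(scalemxAl, scalemxAr) !(E, Z) S; ring.
Qed.

Lemma bilin_delta (R : realType) n (A : 'M[R]_n) i x :
  bilin A (delta_mx i 0) x = (A *m x) i 0.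
Proof. by rewrite /bilin trmx_delta -mulmxA -rowE mxE. Qed.

Lemma bilin0 (R : realType) (n : nat) (A : 'M[R]_n) u : bilin A 0 u = 0.
Proof. by rewrite /bilin trmx0 !mul0mx mxE. Qed.

Lemma d_L (R : realType) (n : nat) (b m : R) (M K : 'M[R]_n)
    (MT : M^T = M) (KT : K^T = K) u x :
  'D_u (damped_lagrangian b m M K) x =
  bilin M (v_of u) (v_of x) - bilin K (q_of u) (q_of x)
   - b / m * z_of u.
Proof.
apply: (@derive_quadratic _ _ _ _ _ _
  (2^-1 * bilin M (v_of u) (v_of u) - 2^-1 * bilin K (q_of u) (q_of u))) => h.
by rewrite /damped_lagrangian v_ofP q_ofP z_ofP !bilinP //; move: (b / m) => k; field.
Qed.

Lemma d_vL (R : realType) (n : nat) (b m : R) (M K : 'M[R]_n)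
    (MT : M^T = M) (KT : K^T = K) i :
 d_v (damped_lagrangian b m M K) i = fun x => (M *m v_of x) i 0.
Proof.
apply/funext => x; rewrite /d_v d_L // v_ofK q_ofK z_ofK bilin_delta bilin0.
by rewrite mulr0 !subr0.
Qed.
Lemma d_qL (R : realType) (n : nat) (b m : R) (M K : 'M[R]_n)
    (MT : M^T = M) (KT : K^T = K) i x :
 d_q (damped_lagrangian b m M K) i x = - (K *m q_of x) i 0.
Proof. by rewrite /d_q d_L // v_ofK q_ofK z_ofK bilin_delta bilin0 mulr0 subr0 sub0r. Qed.
Lemma d_zL (R : realType) (n : nat) (b m : R) (M K : 'M[R]_n)
    (MT : M^T = M) (KT : K^T = K) x :
 d_z (damped_lagrangian b m M K) x = - (b / m).
Proof. by rewrite /d_z d_L // v_ofK q_ofK z_ofK !bilin0 mulr1 subr0 sub0r. Qed.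
Lemma dd_vL (R : realType) (n : nat) (b m : R) (M K : 'M[R]_n)
    (MT : M^T = M) (KT : K^T = K) i u x :
  'D_u (d_v (damped_lagrangian b m M K) i) x = (M *m v_of u) i 0.
Proof.
rewrite d_vL //; apply: (@derive_quadratic _ _ _ _ _ _ 0) => h.
by rewrite v_ofP linearP /= !mxE mulr0 addr0 addrC.
Qed.

Lemma contact_lagrangian_fieldE (R : realType) (n : nat) (b m : R)
    (M K : 'M[R]_n) (X : TQR R n -> TQR R n) :
  M^T = M -> K^T = K -> M \in unitmx ->
  contact_lagrangian_field (damped_lagrangian b m M K) X <->
  X = damped_field b m M K.
Proof.
move=> MT KT MU; split => [H | ->].
  apply/funext => x; have [Hq Hv Hz] := H x.
  rewrite [LHS]tqr_eta Hq Hz; congr tqr.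
  rewrite -[LHS](mulKmx MU) -mulmxN; congr (_ *m _).
  apply/matrixP => i j; rewrite (ord1 j); move: (Hv i).
  rewrite dd_vL // d_qL // d_vL // d_zL // => /eqP; rewrite subr_eq => /eqP ->.
  rewrite !mxE; ring.
move=> x; rewrite /damped_field q_ofK z_ofK; split=> // i.
rewrite dd_vL // d_qL // d_vL // d_zL // v_ofK mulmxN mulKVmx //.
by move: (K *m _) (M *m _) => P W; rewrite !mxE; ring.
Qed.

(* Main.v *)
Require Import Defs.
From HB Require Import structures.
From mathcomp Require Import all_boot all_order all_algebra.
From mathcomp Require Import boolp classical_sets functions reals topology.
From mathcomp Require Import normedtype derive ring lra.
Set Implicit Arguments.
Unset Strict Implicit.
Unset Printing Implicit Defensive.
Import Order.TTheory GRing.Theory Num.Theory numFieldNormedType.Exports.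
Local Open Scope ring_scope.
Local Open Scope classical_set_scope.

(** The field [Gamma] is determined by the equations of motion: it is the
    quadratic polynomial field [damped_field], in particular smooth.  The
    metric is constant, so the Lie derivative evaluated at a vector [w] is
    [2 G(w, DX w)], where [DX] is the Jacobian of the field
    ([lie_derivative_cst]).  For [w = (a, c, s)], writing [k = b / m] and a dot
    for the Euclidean product,

      G(w, w)    = aKa + m c.c + 2 b eps a.c + b s^2,
      G(w, DX w) = - b (1 - eps) c.c - k eps aKa - k b eps a.c - b k s^2
                   + b s (m c.v - aKq).

    With [eps = 0] the first line is positive definite, but the second line
    has no dissipation in the direction [a]: the damping acts on the velocity
    only.  The off-diagonal block [b eps] of the metric transfers part of the
    dissipation to the position, at the price of the indefinite term [a.c].
    The single estimate |2 b eps a.c| <= eps aKa + (m / 2) c.c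
    ([coupling_bound]), which holds for small [eps] because [K] is coercive,
    controls that term both in the metric, which is therefore positive
    definite ([metric_posdef]), and in the Lie derivative.

    The remaining terms [b s (m c.v - aKq)] come from the quadratic part of the
    action equation, and vanish at the origin.  Young's inequality absorbs them
    as soon as [v.v] and [qKq] are small, which defines the neighbourhood.
    Contraction then holds with rate [k eps / 8] ([damped_estimate]). *)

(** * Calculus of smooth maps *)

Lemma class_C_continuous (R : realType) (V W : normedModType R) k
    (f : V -> W) : class_C k f -> continuous f.
Proof. by case: k => [//|k [df _]] x; exact: differentiable_continuous. Qed.

(** The product rule for the class C^(k+1) needs the factors themselves, and
    not only their derivatives, in the class C^k. *)
Lemma class_CW (R : realType) (V W : normedModType R) k (f : V -> W) :
  class_C k.+1 f -> class_C k f.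
Proof.
elim: k f => [|k IHk] f; first exact: class_C_continuous.
by move=> [df Df]; split=> // v; exact: IHk (Df v).
Qed.

Lemma smooth_cst (R : realType) (V W : normedModType R) (w : W) :
  smooth (cst w : V -> W).
Proof.
move=> k; elim: k w => [|k IHk] w; first by move=> x; exact: cvg_cst.
split=> [x|v]; first exact: differentiable_cst.
by rewrite (_ : 'D_v _ = cst 0) //; apply/funext => x; rewrite derive_cst.
Qed.

Lemma class_CD (R : realType) (V W : normedModType R) k (f g : V -> W) :
  class_C k f -> class_C k g -> class_C k (f + g).
Proof.
elim: k f g => [|k IHk] f g; first by move=> cf cg x; exact: cvgD (cf x) (cg x).
move=> [df Df] [dg Dg]; split=> [x|v]; first exact: differentiableD.
rewrite (_ : 'D_v _ = 'D_v f + 'D_v g); first exact: IHk (Df v) (Dg v).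
by apply/funext => x; rewrite deriveD //; exact: diff_derivable.
Qed.

Lemma class_CM (R : realType) (V : normedModType R) k (f g : V -> R) :
  class_C k f -> class_C k g -> class_C k (f * g).
Proof.
elim: k f g => [|k IHk] f g; first by move=> cf cg x; exact: cvgM (cf x) (cg x).
move=> Cf Cg; have [[df Df] [dg Dg]] := (Cf, Cg).
split=> [x|v]; first exact: differentiableM.
rewrite (_ : 'D_v _ = f * 'D_v g + g * 'D_v f).
  by apply: class_CD; apply: IHk; do ?[exact: class_CW]; [exact: Dg|exact: Df].
by apply/funext => x; rewrite deriveM //; exact: diff_derivable.
Qed.

Lemma smoothD (R : realType) (V W : normedModType R) (f g : V -> W) :
  smooth f -> smooth g -> smooth (fun x => f x + g x).
Proof. by move=> sf sg k; exact: class_CD. Qed.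

Lemma smoothM (R : realType) (V : normedModType R) (f g : V -> R) :
  smooth f -> smooth g -> smooth (fun x => f x * g x).
Proof. by move=> sf sg k; exact: class_CM. Qed.

Lemma smoothB (R : realType) (V : normedModType R) (f g : V -> R) :
  smooth f -> smooth g -> smooth (fun x => f x - g x).
Proof.
move=> sf sg; rewrite (_ : (fun x => _) = fun x => f x + -1 * g x); last first.
  by apply/funext => x; rewrite mulN1r.
by apply: smoothD => //; apply: smoothM => //; exact: smooth_cst.
Qed.

Lemma smooth_sum (R : realType) (V W : normedModType R) (I : Type) (r : seq I)
    (f : I -> V -> W) :
  (forall i, smooth (f i)) -> smooth (fun x => \sum_(i <- r) f i x).
Proof.
move=> sf; rewrite -fct_sumE; elim/big_ind: _ => //; first exact: smooth_cst.
by move=> *; exact: smoothD.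
Qed.

Lemma smoothZl (R : realType) (V W : normedModType R) (f : V -> R) (w : W) :
  smooth f -> smooth (fun x => f x *: w).
Proof.
move=> sf k; elim: k f {sf}(sf k) => [|k IHk] f.
  by move=> cf x; exact: cvgZr_tmp (cf x).
move=> [df Df]; split=> [x|v]; first exact: differentiableZl.
rewrite (_ : 'D_v _ = (fun x => 'D_v f x *: w)); first exact: IHk (Df v).
apply/funext => x.
by rewrite !deriveE ?diffZl//; exact: differentiableZl.
Qed.

Lemma smooth_coord (R : realType) (m n : nat) i j :
  smooth (fun A : 'M[R]_(m, n) => A i j : R).
Proof.
case=> [|k]; first exact: coord_continuous.
split=> [x|v]; first exact: differentiable_coord.
rewrite (_ : 'D_v _ = cst (v i j)); first exact: smooth_cst.
apply/funext => x; apply: (@derive_quadratic _ _ _ _ _ _ 0) => h.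
by rewrite !mxE mulr0 addr0 addrC.
Qed.

(** Reduces smoothness to scalar functions, where products are available. *)
Lemma smooth_mx (R : realType) (V : normedModType R) (m n : nat)
    (f : V -> 'M[R]_(m, n)) :
  (forall i j, smooth (fun x => f x i j)) -> smooth f.
Proof.
move=> sf; rewrite (_ : f = fun x =>
    \sum_(i < m) \sum_(j < n) f x i j *: delta_mx i j); last first.
  by apply/funext => x; exact: matrix_sum_delta.
by do 2![apply: smooth_sum => ?]; exact: smoothZl.
Qed.

Lemma smooth_mulmx (R : realType) (V : normedModType R) (m n p : nat)
    (f : V -> 'M[R]_(m, n)) (g : V -> 'M[R]_(n, p)) :
  (forall i j, smooth (fun x => f x i j)) ->
  (forall i j, smooth (fun x => g x i j)) ->
  forall i j, smooth (fun x => (f x *m g x) i j).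
Proof.
move=> sf sg i j.
rewrite (_ : (fun x => _) = fun x => \sum_k f x i k * g x k j); last first.
  by apply/funext => x; rewrite mxE.
by apply: smooth_sum => k; exact: smoothM.
Qed.

Lemma smooth_bilin (R : realType) (V : normedModType R) (d : nat) (A : 'M[R]_d)
    (f g : V -> 'cV[R]_d) :
  (forall i, smooth (fun x => f x i 0)) ->
  (forall i, smooth (fun x => g x i 0)) ->
  smooth (fun x => bilin A (f x) (g x)).
Proof.
move=> sf sg; apply: smooth_mulmx => [i j|i j]; last by rewrite (ord1 j).
apply: smooth_mulmx => k l; last exact: smooth_cst.
by rewrite (_ : (fun x => _) = fun x => f x l 0) //;
   apply/funext => x; rewrite mxE (ord1 k).
Qed.

Lemma open_sublevel (R : realType) (V : normedModType R) (f : V -> R) (r : R) :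
  smooth f -> open [set x | f x < r].
Proof.
by move=> sf; apply: (@open_comp _ _ f [set y | y < r]);
  [move=> x _; exact: (sf 0%N)|exact: open_lt].
Qed.

(** * Smoothness of the damped field *)

Lemma smooth_q_of (R : realType) n i : smooth (fun x : TQR R n => q_of x i 0).
Proof.
rewrite (_ : (fun x => _) = fun x : TQR R n => x (lshift 1 (lshift n i)) 0).
  exact: smooth_coord.
by apply/funext => x; rewrite !mxE.
Qed.

Lemma smooth_v_of (R : realType) n i : smooth (fun x : TQR R n => v_of x i 0).
Proof.
rewrite (_ : (fun x => _) = fun x : TQR R n => x (lshift 1 (rshift n i)) 0).
  exact: smooth_coord.
by apply/funext => x; rewrite !mxE.
Qed.

Lemma smooth_z_of (R : realType) n : smooth (fun x : TQR R n => z_of x).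
Proof.
rewrite (_ : (fun x => _) = fun x : TQR R n => x (rshift (n + n) 0) 0).
  exact: smooth_coord.
by apply/funext => x; rewrite /z_of mxE.
Qed.

Lemma smooth_tqr (R : realType) (V : normedModType R) n (q v : V -> 'cV[R]_n)
    (z : V -> R) :
  (forall i, smooth (fun x => q x i 0)) ->
  (forall i, smooth (fun x => v x i 0)) -> smooth z ->
  smooth (fun x => tqr (q x) (v x) (z x)).
Proof.
move=> sq sv sz; apply: smooth_mx => i j; rewrite (ord1 j).
case: (split_ordP i) => [i' ->|i' ->]; last first.
  rewrite (_ : (fun x => _) = z) //.
  by apply/funext => x; rewrite /tqr col_mxEd (ord1 i') mxE eqxx.
case: (split_ordP i') => [k ->|k ->].
  by rewrite (_ : (fun x => _) = fun x => q x k 0) //;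
     apply/funext => x; rewrite /tqr !col_mxEu.
by rewrite (_ : (fun x => _) = fun x => v x k 0) //;
   apply/funext => x; rewrite /tqr col_mxEu col_mxEd.
Qed.

Lemma smooth_damped_field (R : realType) n (b m : R) (M K : 'M[R]_n) :
  smooth (damped_field b m M K).
Proof.
have smul (A : 'M[R]_n) (f : TQR R n -> 'cV[R]_n) :
    (forall i, smooth (fun x => f x i 0)) ->
    forall i, smooth (fun x => (A *m f x) i 0).
  move=> sf i; apply: smooth_mulmx => [k l|k l]; first exact: smooth_cst.
  by rewrite (ord1 l).
apply: smooth_tqr => [i|i|]; first exact: smooth_v_of.
  rewrite (_ : (fun x => _) = fun x => ((- invmx M) *m
    (K *m q_of x + (b / m) *: (M *m v_of x))) i 0); last first.
    by apply/funext => x; rewrite mulNmx.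
  apply: (smul _ (fun x => K *m q_of x + (b / m) *: (M *m v_of x))) => {}i.
  rewrite (_ : (fun x => _) = fun x =>
    (K *m q_of x) i 0 + b / m * (M *m v_of x) i 0); last first.
    by apply/funext => x; rewrite mxE [X in _ + X = _]mxE.
  apply: smoothD; first by exact: (smul _ _ (@smooth_q_of R n)).
  by apply: smoothM; [exact: smooth_cst|exact: (smul _ _ (@smooth_v_of R n))].
have half (f : TQR R n -> R) : smooth f ->
    smooth (fun x : TQR R n => 2^-1 * f x).
  by move=> sf; apply: smoothM => //; exact: smooth_cst.
apply: smoothB; first apply: smoothB.
- by apply: half; apply: smooth_bilin => i; exact: smooth_v_of.
- by apply: half; apply: smooth_bilin => i; exact: smooth_q_of.
- by apply: smoothM; [exact: smooth_cst|exact: smooth_z_of].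
Qed.

(** * Positive definite forms *)

Lemma bilinC (R : realType) d (A : 'M[R]_d) (x y : 'cV[R]_d) :
  A^T = A -> bilin A x y = bilin A y x.
Proof.
move=> AT; rewrite /bilin -[in LHS](trmxK (x^T *m A *m y)) [LHS]mxE.
by rewrite !trmx_mul AT trmxK mulmxA.
Qed.

(** Young's inequality for the form [A], read off from the nonnegativity of
    [A] at [h x + y]; the weight [h] may have either sign. *)
Lemma bilin_young (R : realType) d (A : 'M[R]_d) (h : R) (x y : 'cV[R]_d) :
  sym_posdef A ->
  - (h * (2 * bilin A x y)) <= bilin A y y + h * h * bilin A x x.
Proof.
move=> [AT Apos]; rewrite -subr_ge0 opprK addrAC -bilinP //.
have [->|w0] := eqVneq (h *: x + y) 0; first by rewrite bilin0.
exact/ltW/Apos.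
Qed.

Lemma bilin_scalar (R : realType) d (a : R) (x y : 'cV[R]_d) :
  bilin a%:M x y = a * bilin 1%:M x y.
Proof. by rewrite /bilin mul_mx_scalar mulmx1 -scalemxAl mxE. Qed.

Lemma bilin1E (R : realType) d (x : 'cV[R]_d) :
  bilin 1%:M x x = \sum_i x i 0 * x i 0.
Proof. by rewrite /bilin mulmx1 mxE; apply: eq_bigr => i _; rewrite mxE. Qed.

Lemma bilin1_ge0 (R : realType) d (x : 'cV[R]_d) : 0 <= bilin 1%:M x x.
Proof. by rewrite bilin1E; apply: sumr_ge0 => i _; exact: sqr_ge0. Qed.

Lemma sym_posdef_scalar (R : realType) d (a : R) :
  0 < a -> sym_posdef (a%:M : 'M_d).
Proof.
move=> a0; split=> [|v v0]; first exact: tr_scalar_mx.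
rewrite bilin_scalar mulr_gt0 // lt_neqAle bilin1_ge0 andbT eq_sym.
apply: contra v0 => /eqP; rewrite bilin1E => v2; apply/eqP/colP => i.
rewrite mxE; apply/eqP; rewrite -sqrf_eq0 expr2; apply/eqP.
by apply: (psumr_eq0P _ v2) => // j _; exact: sqr_ge0.
Qed.

Lemma bilin_le_sqr (R : realType) d (A : 'M[R]_d) :
  exists2 C : R, 0 < C & forall x, bilin A x x <= C * bilin 1%:M x x.
Proof.
have sqr_le (x : 'cV[R]_d) i : x i 0 * x i 0 <= bilin 1%:M x x.
  rewrite bilin1E (bigD1 i) //= lerDl; apply: sumr_ge0 => j _; exact: sqr_ge0.
(* The summand 1 keeps the constant positive when A = 0. *)
exists (1 + \sum_i \sum_j `|A j i|).
  by rewrite ltr_pwDl // sumr_ge0 // => i _; exact: sumr_ge0.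
move=> x; rewrite mulrDl mul1r ler_wpDl ?bilin1_ge0 // {1}/bilin mxE mulr_suml.
rewrite ler_sum // => i _.
rewrite mxE !mulr_suml ler_sum // => j _.
have xx : `|x j 0 * x i 0| <= bilin 1%:M x x.
  have := sqr_le x i; have := sqr_le x j; move: (bilin _ x x) => B.
  by rewrite ler_norml; nra.
by rewrite mxE mulrAC mulrC (le_trans (ler_norm _)) // normrM ler_wpM2l.
Qed.

Lemma sym_posdef_unit (R : realType) d (A : 'M[R]_d) :
  sym_posdef A -> A \in unitmx.
Proof.
move=> [AT Apos]; rewrite -row_free_unit; apply: inj_row_free => v vA0.
apply/eqP/negP => /negP v0; have /Apos : v^T != 0.
  by rewrite -(trmx0 R) (inj_eq trmx_inj).
by rewrite /bilin trmxK vA0 mul0mx mxE ltxx.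
Qed.

(** Coercivity without compactness: Young's inequality at [y = A^-1 x] with
    weight [-1/C] gives [2/C x.x <= xAx + C^-2 x A^-1 x], and the last term is
    at most [x.x / C] when [C x.x] bounds the quadratic form of [A^-1]. *)
Lemma sym_posdef_coercive (R : realType) d (A : 'M[R]_d) : sym_posdef A ->
  exists2 kappa : R, 0 < kappa &
    forall x, kappa * bilin 1%:M x x <= bilin A x x.
Proof.
move=> Apd; have AU := sym_posdef_unit Apd; have [AT _] := Apd.
have [C C0 CP] := bilin_le_sqr (invmx A).
exists C^-1; first by rewrite invr_gt0.
move=> x; have yA : (invmx A *m x)^T *m A = x^T.
  by rewrite trmx_mul trmx_inv AT mulmxKV.
have := bilin_young (- C^-1) (invmx A *m x) x Apd.
have -> : bilin A (invmx A *m x) x = bilin 1%:M x x by rewrite /bilin yA mulmx1.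
have -> : bilin A (invmx A *m x) (invmx A *m x) = bilin (invmx A) x x.
  by rewrite /bilin yA mulmxA.
have : C^-1 * C^-1 * bilin (invmx A) x x <= C^-1 * bilin 1%:M x x.
  by rewrite -mulrA ler_pM2l ?invr_gt0 // ler_pdivrMl.
by rewrite mulrNN mulNr; lra.
Qed.

(** * Jacobian of the field and Lie derivative of the metric *)

(** Allows the Jacobian of a quadratic field to be computed on whole vectors,
    with no recourse to coordinates. *)
Lemma derive_quadratic_vec (R : realType) (V W : normedModType R) (F : V -> W)
    x v a c :
  (forall h : R, F (h *: v + x) = F x + h *: a + (h * h) *: c) -> 'D_v F x = a.
Proof.
move=> FE; rewrite /derive; apply/cvg_lim => //.
apply: (@cvg_trans _ ((fun h : R => a + h *: c) @ 0^')).
  apply: near_eq_cvg; near=> h.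
  have h0 : h != 0 by near: h; exact: nbhs_dnbhs_neq.
  rewrite /= FE -(addrA (F x)) [F x + _]addrC addrK.
  by rewrite scalerDr !scalerA mulrA mulVf // mul1r scale1r.
suff: (fun h : R => a + h *: c) @ 0 --> a + 0 *: c.
  by rewrite scale0r addr0; apply: cvg_trans; apply: cvg_app; exact: cvg_within.
by apply: cvgD; [exact: cvg_cst|apply: cvgZr_tmp; exact: cvg_id].
Unshelve. all: by end_near. Qed.

Lemma tqrP (R : realType) n (h : R) (a c a' c' : 'cV[R]_n) s s' :
  tqr (h *: a + a') (h *: c + c') (h * s + s') =
  h *: tqr a c s + tqr a' c' s' :> TQR R n.
Proof.
by rewrite /tqr !scale_col_mx !add_col_mx raddfD /= scale_scalar_mx.
Qed.

Lemma derive_damped_field (R : realType) n (b m : R) (M K : 'M[R]_n)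
    (MT : M^T = M) (KT : K^T = K) (x : TQR R n) (a c : 'cV[R]_n) (s : R) :
  'D_(tqr a c s) (damped_field b m M K) x =
  tqr c (- (invmx M *m (K *m a + (b / m) *: (M *m c))))
    (bilin M c (v_of x) - bilin K a (q_of x) - b / m * s).
Proof.
apply: (@derive_quadratic_vec _ _ _ _ _ _ _
  (tqr 0 0 (2^-1 * bilin M c c - 2^-1 * bilin K a a))) => h.
rewrite /damped_field q_ofP v_ofP z_ofP q_ofK v_ofK z_ofK !bilinP //.
rewrite [RHS]addrC [X in _ = _ + X]addrC -!tqrP; congr tqr.
- by rewrite scaler0 add0r.
- rewrite scaler0 add0r scalerN -opprD [in RHS]scalemxAr; congr (- _).
  rewrite -mulmxDr; congr (_ *m _).
  by rewrite !mulmxDr -!scalemxAr !scalerDr !scalerA mulrC addrACA.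
- by move: (b / m) => k; field.
Qed.

(** A constant metric has no derivative of its own, and the bracket of [X] with
    a constant field is minus the directional derivative of [X]. *)
Lemma lie_derivative_cst (R : realType) d (X : 'cV[R]_d -> 'cV[R]_d)
    (G : 'M[R]_d) (x v : 'cV[R]_d) : G^T = G ->
  lie_derivative X (cst G) x v v = 2 * bilin G v ('D_v X x).
Proof.
move=> GT; rewrite /lie_derivative /lie_bracket /= !derive_cst.
rewrite /cst /= !sub0r.
have -> : 'D_(X x) (fun y => bilin G v v) x = 0 by exact: derive_cst.
have N w : bilin G v (- w) = - bilin G v w by rewrite /bilin mulmxN mxE.
by rewrite (bilinC (- _)) // N; ring.
Qed.

Lemma bilin_metric (R : realType) n (b : R) (M K : 'M[R]_n) eps
    (a c a' c' : 'cV[R]_n) (s s' : R) :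
  bilin (contact_contraction_metric b M K eps) (tqr a c s) (tqr a' c' s') =
  bilin K a a' + bilin M c c'
  + b * eps * (bilin 1%:M a c' + bilin 1%:M c a') + b * (s * s').
Proof.
rewrite /bilin /contact_contraction_metric /tqr !tr_col_mx tr_scalar_mx.
rewrite !mul_row_block !mul_row_col !mulmx0 !add0r !addr0.
rewrite mul_row_col !mulmxDl -!scalar_mxM !mul_mx_scalar -!scalemxAl !scale1r.
have D (P Q : 'M[R]_1) : (P + Q) 0 0 = P 0 0 + Q 0 0 by rewrite mxE.
have Z (k : R) (P : 'M[R]_1) : (k *: P) 0 0 = k * P 0 0 by rewrite mxE.
have S (k : R) : (k%:M : 'M_1) 0 0 = k by rewrite mxE eqxx.
by rewrite !(D, Z, S); ring.
Qed.

Lemma tr_contact_contraction_metric (R : realType) n (b : R) (M K : 'M[R]_n)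
    eps :
  M^T = M -> K^T = K ->
  (contact_contraction_metric b M K eps)^T =
  contact_contraction_metric b M K eps.
Proof.
by move=> MT KT; rewrite /contact_contraction_metric !tr_block_mx !tr_scalar_mx
  MT KT !trmx0.
Qed.

(** The contributions [aKc] of the [K] block and [- cKa] of the velocity
    equation cancel, as the energy of the undamped oscillator is conserved. *)
Lemma bilin_metric_field (R : realType) n (b m : R) (K : 'M[R]_n) eps
  (x : TQR R n) (a c : 'cV[R]_n) (s : R) : 0 < m -> K^T = K ->
  bilin (contact_contraction_metric b m%:M K eps) (tqr a c s)
    ('D_(tqr a c s) (damped_field b m m%:M K) x) =
  - (b * (1 - eps)) * bilin 1%:M c c - b * eps / m * bilin K a a
  - b / m * (b * eps) * bilin 1%:M a c - b * (b / m) * (s * s)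
  + b * (s * (m * bilin 1%:M c (v_of x)) - s * bilin K a (q_of x)).
Proof.
move=> m0 KT; rewrite derive_damped_field ?tr_scalar_mx // bilin_metric.
have -> : - (invmx m%:M *m (K *m a + (b / m) *: (m%:M *m c))) =
    - (m^-1 *: (K *m a) + (b / m) *: c).
  rewrite invmx_scalar mul_scalar_mx scalerDr mul_scalar_mx !scalerA.
  by congr (- (_ + _ *: _)); field; exact: lt0r_neq0.
have E y : bilin 1%:M y (- (m^-1 *: (K *m a) + (b / m) *: c)) =
    - (m^-1 * bilin K y a + b / m * bilin 1%:M y c).
  have D (P Q : 'M[R]_1) : (P + Q) 0 0 = P 0 0 + Q 0 0 by rewrite mxE.
  have Z (k : R) (P : 'M[R]_1) : (k *: P) 0 0 = k * P 0 0 by rewrite mxE.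
  by rewrite /bilin mulmxN mxE mulmxDr -!scalemxAr mulmx1 mulmxA !(D, Z).
rewrite !(bilin_scalar m) !E (bilinC c a KT); field; exact: lt0r_neq0.
Qed.

(** * Contraction estimates *)

(** Young's inequality in the Euclidean form with weight [kappa / b], followed
    by coercivity; the smallness of [eps] turns the resulting coefficient
    [b^2 eps / kappa] of [c.c] into [m / 2]. *)
Lemma coupling_bound (R : realType) n (K : 'M[R]_n) (b m kappa eps : R)
  (a c : 'cV[R]_n) : 0 < b -> 0 < kappa -> 0 <= eps ->
  2 * b * b * eps <= m * kappa ->
  (forall x, kappa * bilin 1%:M x x <= bilin K x x) ->
  `|2 * b * eps * bilin 1%:M a c|
    <= eps * bilin K a a + m / 2 * bilin 1%:M c c.
Proof.
move=> b0 k0 e0 epsP /(_ a) Kcoer.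
pose h := kappa / b; have h0 : 0 < h by exact: divr_gt0.
have kE : kappa = h * b by rewrite divfK ?gt_eqF.
have epsP' : 2 * b * eps <= m * h.
  by rewrite -(ler_pM2r b0) -(mulrA m) -kE; lra.
have I1 : sym_posdef (1%:M : 'M[R]_n) by exact/sym_posdef_scalar.
have := bilin_young h a c I1; have := bilin_young (- h) a c I1.
have := bilin1_ge0 c; move: Kcoer; rewrite kE.
move: (bilin _ a a) (bilin _ c c) (bilin _ a c) (bilin K a a) => aa cc ac A.
move=> Kcoer cc0 Y1 Y2.
have be0 : 0 <= b * eps by rewrite mulr_ge0 // ltW.
have H1 := ler_wpM2l be0 Y1; have H2 := ler_wpM2l be0 Y2.
have H3 := ler_wpM2r cc0 epsP'.
have H4 := ler_wpM2l (mulr_ge0 (ltW h0) e0) Kcoer.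
rewrite ler_norml; apply/andP; split; rewrite -(ler_pM2l h0); lra.
Qed.

Lemma metric_posdef (R : realType) n (b m kappa eps : R) (K : 'M[R]_n) :
  0 < b -> 0 < m -> 0 < kappa -> sym_posdef K -> 0 <= eps -> 4 * eps <= 1 ->
  2 * b * b * eps <= m * kappa ->
  (forall x, kappa * bilin 1%:M x x <= bilin K x x) ->
  sym_posdef (contact_contraction_metric b m%:M K eps).
Proof.
move=> b0 m0 k0 [KT Kpos] e0 e4 epsP Kcoer.
split=> [|w]; first by rewrite tr_contact_contraction_metric // tr_scalar_mx.
rewrite (tqr_eta w); move: (q_of w) (v_of w) (z_of w) => a c s {w} w0.
have := coupling_bound a c b0 k0 e0 epsP Kcoer.
rewrite bilin_metric bilin_scalar (bilinC c a) ?tr_scalar_mx //.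
rewrite ler_norml => /andP[P _].
have I1 : sym_posdef (1%:M : 'M[R]_n) by exact/sym_posdef_scalar.
have A0 : 0 <= bilin K a a.
  exact: le_trans (mulr_ge0 (ltW k0) (bilin1_ge0 a)) (Kcoer a).
have c0 : 0 <= m * bilin 1%:M c c by rewrite mulr_ge0 ?bilin1_ge0 // ltW.
have s0 : 0 <= b * (s * s) by rewrite mulr_ge0 ?sqr_ge0 // ltW.
have eA := ler_wpM2r A0 e4.
suff : [|| 0 < bilin K a a, 0 < m * bilin 1%:M c c | 0 < b * (s * s)].
  by case/or3P => ?; lra.
have [a0|a0] := eqVneq a 0; last by rewrite Kpos.
have [c00|c00] := eqVneq c 0; last by rewrite mulr_gt0 ?orbT //; apply I1.
rewrite [X in [|| _, _ | X]]pmulr_rgt0 // -expr2 exprn_even_gt0 //=.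
rewrite [s == 0](_ : _ = false) ?orbT //; apply/negbTE.
by apply: contra w0 => /eqP ->; rewrite a0 c00 /tqr raddf0 !col_mx0.
Qed.

(** The scalar form of the contraction inequality.  Here [A], [c2] and [ac]
    stand for [aKa], [c.c] and [a.c].  The products [s * mvc] and [s * qKa]
    vanish at the origin; the hypotheses on them, multiplied by [b], let them
    consume at most [b c2 / 4], [k eps A / 4] and [b k s^2 / 2] of the
    dissipation, where [k = b / m].  The coupling term [ac] takes at most
    [k eps A / 2] and [b c2 / 4]; what is left dominates the metric. *)
Lemma damped_estimate (R : realType) (A c2 ac s mvc qKa b m eps : R) :
  0 < b -> 0 < m -> 0 < eps -> 4 * eps <= 1 -> 0 <= A -> 0 <= c2 ->
  `|2 * b * eps * ac| <= eps * A + m / 2 * c2 ->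
  s * mvc <= c2 / 4 + b / m / 4 * (s * s) ->
  - (s * qKa) <= eps / m / 4 * A + b / m / 4 * (s * s) ->
  - (b * (1 - eps)) * c2 - b * eps / m * A - b / m * (b * eps) * ac
    - b * (b / m) * (s * s) + b * (s * mvc - s * qKa)
  <= - (b / m * eps / 8 * (A + m * c2 + b * eps * (ac + ac) + b * (s * s))).
Proof.
move=> b0 m0 e0 e4 A0 c0.
pose k := b / m; have k0 : 0 < k by exact: divr_gt0.
have bE : b = k * m by rewrite divfK ?gt_eqF.
rewrite -/k ler_norml => /andP[P1 P2] C1 C2.
have beE : b * eps / m = k * eps by rewrite /k mulrAC.
have C1' := ler_wpM2l (ltW b0) C1.
have C2' : b * - (s * qKa) <= k * eps / 4 * A + b * k / 4 * (s * s).
  apply: le_trans (ler_wpM2l (ltW b0) C2) _; rewrite -beE.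
  by rewrite le_eqVlt; apply/orP; left; apply/eqP; field; exact: lt0r_neq0.
have P1' := ler_wpM2l (ltW k0) P1; have ke0 := mulr_gt0 k0 e0.
have P2' := ler_wpM2l (ltW ke0) P2.
have keA := mulr_ge0 (ltW ke0) A0; have kmc := mulr_ge0 (ltW b0) c0.
have s0 : 0 <= b * k * (s * s) by rewrite mulr_ge0 ?sqr_ge0 // ltW // mulr_gt0.
have Q1 := ler_wpM2l keA e4; have Q2 := ler_wpM2l kmc e4.
have Q3 := ler_wpM2l s0 e4.
rewrite beE; rewrite bE in kmc s0 Q2 Q3 C1' C2' P1' P2' *.
lra.
Qed.

(** * The contracting system *)

Theorem theorem4 (R : realType) (n : nat) (b m : R) (hb : 0 < b) (hm : 0 < m)
    (M K : 'M[R]_n) (hM : M = m%:M) (hK : sym_posdef K)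
    (hKM : K *m invmx M = invmx M *m K)
    (Gamma : TQR R n -> TQR R n)
    (hGamma : contact_lagrangian_field (damped_lagrangian b m M K) Gamma) :
  exists (U : set (TQR R n)) (eps : R),
    open_nbhs (tqr 0 0 0 : TQR R n) U /\
    contracting_system Gamma (cst (contact_contraction_metric b M K eps)) U.
Proof.
have [KT _] := hK; have MT : M^T = M by rewrite hM tr_scalar_mx.
have MU : M \in unitmx by rewrite hM; exact/sym_posdef_unit/sym_posdef_scalar.
move: hGamma; rewrite contact_lagrangian_fieldE // => ->.
rewrite {}hM in MT MU hKM *.
have [kappa k0 Kcoer] := sym_posdef_coercive hK.
(* This quotient is below 1/4 and below m kappa / (4 b^2). *)
have [eps e0 [e4 epsP]] : exists2 eps : R, 0 < eps &
    4 * eps <= 1 /\ 2 * b * b * eps <= m * kappa.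
  have mk0 : 0 < m * kappa by exact: mulr_gt0.
  have bb0 : 0 < b * b by exact: mulr_gt0.
  have D0 : 0 < 4 * (m * kappa) + 4 * (b * b) by lra.
  exists (m * kappa / (4 * (m * kappa) + 4 * (b * b))); first exact: divr_gt0.
  by rewrite !mulrA !ler_pdivrMr //; nra.
have kb0 : 0 < b / m by exact: divr_gt0.
pose U :=
  [set x : TQR R n | m * m * bilin 1%:M (v_of x) (v_of x) < b / m / 4] `&`
  [set x : TQR R n | bilin K (q_of x) (q_of x) < b / m / 4 * (eps / m)].
have Uo : open U.
  apply: openI; apply: open_sublevel; last first.
    by apply: smooth_bilin => i; exact: smooth_q_of.
  apply: smoothM; first exact: smooth_cst.
  by apply: smooth_bilin => i; exact: smooth_v_of.
exists U, eps; split.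
  split=> //; split => /=; rewrite ?v_ofK ?q_ofK bilin0 ?mulr0.
    by rewrite divr_gt0.
  by rewrite mulr_gt0 // divr_gt0.
have Gpd := metric_posdef hb hm k0 hK (ltW e0) e4 epsP Kcoer.
split=> //; first exact: smooth_damped_field.
  by split=> //; exact: smooth_cst.
exists (b / m * eps / 8); first by rewrite !mulr_gt0 // invr_gt0.
move=> x [/= Uv Uq] w; rewrite lie_derivative_cst; last by case: Gpd.
rewrite /cst (tqr_eta w); move: (q_of w) (v_of w) (z_of w) => a c s {w}.
rewrite bilin_metric_field // bilin_metric bilin_scalar.
rewrite (bilinC c a) ?tr_scalar_mx //.
have I1 : sym_posdef (1%:M : 'M[R]_n) by exact/sym_posdef_scalar.
have A0 : 0 <= bilin K a a.
  exact: le_trans (mulr_ge0 (ltW k0) (bilin1_ge0 a)) (Kcoer a).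
have P := coupling_bound a c hb k0 (ltW e0) epsP Kcoer.
(* The weights make the coefficient of c.c equal to 1/4 and that of aKa equal to
   eps / (4 m), as [damped_estimate] requires. *)
have Yv := bilin_young (- (2 * s * m)) (v_of x) c I1.
have Yq := bilin_young (2 * m / eps * s) (q_of x) a hK.
have ss0 : 0 <= s * s by exact: sqr_ge0.
rewrite -[leRHS]mulrA [leRHS]mulNr -[leRHS]mulrN ler_pM2l //.
apply: damped_estimate => //; first exact: bilin1_ge0.
  rewrite (bilinC c) ?tr_scalar_mx //; have := ler_wpM2r ss0 (ltW Uv); lra.
rewrite (bilinC a) //; have em0 : 0 < eps / m / 4 by rewrite !divr_gt0.
have em : eps / m != 0 by rewrite gt_eqF // divr_gt0.
have H1 := ler_wpM2l (ltW em0) Yq.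
have -> : - (s * bilin K (q_of x) a) = eps / m / 4 *
    - (2 * m / eps * s * (2 * bilin K (q_of x) a)).
  by field; rewrite !lt0r_neq0.
apply: le_trans H1 _; rewrite mulrDr lerD2l.
have -> : eps / m / 4 * (2 * m / eps * s * (2 * m / eps * s) *
    bilin K (q_of x) (q_of x)) =
   (bilin K (q_of x) (q_of x) / (eps / m)) * (s * s).
  by field; rewrite !lt0r_neq0.
by rewrite ler_wpM2r // ler_pdivrMr ?divr_gt0 // ltW.
Qed.
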